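(* There cannot exist a good procedure for estimating the mean squared error of a nontrivial estimator. That is, if $\tilde M$ is a nontrivial estimator, then no procedure $\mathrm P$ computing from the data only an estimate $\widehat{\operatorname{MSE}}_{\mathrm P}(\tilde M)$ of the mean squared error of $\tilde M$ is good.
   Context: Setting: a parameter matrix is a real $m\times n$ matrix $M$ ($m\le n$ arbitrary positive integers) with all entries bounded by $1$ in absolute value. A data matrix with mean $M$ is a random $m\times n$ matrix $X$ with $\mathbb{E}(x_{ij})=m_{ij}$, $|x_{ij}|\le 1$ almost surely, and independent entries (or, when $m=n$, also: $M,X$ symmetric, or $X-M$ skew-symmetric, with independent entries on and above the diagonal). The choice $X=M$ (no randomness) is allowed. All entries of $X$ are observed. An estimator $\tilde M$ is a rule (measurable function) assigning to each data matrix $X$ (of any size) a matrix $\tilde M$ of the same size, depending on $X$ only. Its mean squared error under $(M,X)$ is $\operatorname{MSE}(\tilde M):=\mathbb{E}\big[\frac1{mn}\sum_{i=1}^m\sum_{j=1}^n(\tilde m_{ij}-m_{ij})^2\big]$. For a sequence of parameter matrices $M_n$ (of possibly varying dimensions) with data matrices $X_n$, $\tilde M_n$ denotes the estimate computed from $X_n$. The trivial estimator is $\hat M^{\mathrm{Trv}}:=X$. An estimator $\tilde M$ is nontrivial if there exist a sequence of parameter matrices $M_n$ and data matrices $X_n$ with means $M_n$ such that $\operatorname{MSE}(\hat M^{\mathrm{Trv}}_n)\not\to0$ as $n\to\infty$ but $\lim_{n\to\infty}\operatorname{MSE}(\tilde M_n)=0$. A procedure $\mathrm P$ is a rule (measurable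 function) that assigns to each data matrix $X$ a real number $\widehat{\operatorname{MSE}}_{\mathrm P}(\tilde M)$, depending on $X$ only. It is good (for $\tilde M$) if both of the following hold: (a) whenever $M_n$ is a sequence of parameter matrices and $X_n$ a sequence of data matrices with means $M_n$ such that $\operatorname{MSE}(\tilde M_n)\to0$, then $\widehat{\operatorname{MSE}}_{\mathrm P}(\tilde M_n)\to0$ in probability; (b) whenever $M_n$ is a sequence of parameter matrices and $X_n$ a sequence of data matrices with means $M_n$ such that $\operatorname{MSE}(\tilde M_n)$ does not tend to zero, then $\widehat{\operatorname{MSE}}_{\mathrm P}(\tilde M_n)$ does not tend to zero in probability. *)

(* Defs.v *)
From HB Require Import structures.
From mathcomp Require Import all_boot all_order all_algebra.
From mathcomp Require Import all_classical all_reals all_analysis.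

Set Implicit Arguments.
Unset Strict Implicit.
Unset Printing Implicit Defensive.

Import Order.TTheory GRing.Theory Num.Theory.
Import numFieldNormedType.Exports.

Local Open Scope classical_set_scope.
Local Open Scope ring_scope.

(* The product sigma-algebra on m x n matrices: it is generated by the entry
   maps A |-> A i j, R carrying its Borel sigma-algebra. *)
Definition mx_cylinder (R : realType) (m n : nat) : set (set 'M[R]_(m, n)) :=
  [set C | exists i j (B : set R),
     measurable B /\ C = [set A : 'M[R]_(m, n) | B (A i j)]].

HB.instance Definition _ (R : realType) (m n : nat) :=
  @isMeasurable.Build (sigma_display (@mx_cylinder R m n)) 'M[R]_(m, n)
    <<s @mx_cylinder R m n >>
    (@sigma_algebra0 _ setT (@mx_cylinder R m n))
    (@sigma_algebraC 'M[R]_(m, n) (@mx_cylinder R m n))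
    (@sigma_algebra_bigcup _ setT (@mx_cylinder R m n)).

(* Mutual independence of the real random variables Y i, i \in D: the product
   rule holds for every subfamily J of D. *)
Definition mutually_independent d (T : measurableType d) (R : realType)
    (P : probability T R) (I : finType) (D : {set I}) (Y : I -> T -> R) : Prop :=
  forall (J : {set I}) (B : I -> set R),
    J \subset D -> (forall i, i \in J -> measurable (B i)) ->
    P (\bigcap_(i in [set` J]) (Y i @^-1` B i)) =
    (\prod_(i in J) P (Y i @^-1` B i))%E.

Section DataMatrix.
Context d (T : measurableType d) (R : realType) (P : probability T R).
Context (m n : nat).
Implicit Types (M : 'M[R]_(m, n)) (X : T -> 'M[R]_(m, n)).

Definition entries X (p : 'I_m * 'I_n) : T -> R := fun w => X w p.1 p.2.

Definition independent_entries X : Prop :=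
  mutually_independent P [set: 'I_m * 'I_n]%SET (entries X).

Definition independent_upper_entries X : Prop :=
  mutually_independent P [set p : 'I_m * 'I_n | (p.1 <= p.2)%N]%SET (entries X).

(* When m = n, castmx only retypes a matrix as an n x n one. *)
Definition symmetric_model M X : Prop :=
  exists e : m = n,
    [/\ (castmx (e, erefl n) M)^T = castmx (e, erefl n) M,
        {ae P, forall w,
          (castmx (e, erefl n) (X w))^T = castmx (e, erefl n) (X w)} &
        independent_upper_entries X].

Definition skew_symmetric_model M X : Prop :=
  exists e : m = n,
    {ae P, forall w,
      (castmx (e, erefl n) (X w - M))^T = - castmx (e, erefl n) (X w - M)} /\
    independent_upper_entries X.

Definition parameter_matrix M : Prop := forall i j, `|M i j| <= 1.

Definition data_matrix M (X : {RV P >-> 'M[R]_(m, n)}) : Prop :=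
  [/\ forall i j, {ae P, forall w, `|X w i j| <= 1},
      forall i j, 'E_P[fun w => X w i j]%E = (M i j)%:E &
      [\/ independent_entries X,
          symmetric_model M X |
          skew_symmetric_model M X]].

End DataMatrix.

(* A parameter matrix together with a data matrix having it as mean; the
   dimensions and the underlying probability space are part of the model, so
   they may vary along a sequence [nat -> model R]. *)
Record model (R : realType) := Model {
  nrows : nat;
  ncols : nat;
  dims_ok : (0 < nrows <= ncols)%N;
  disp : measure_display;
  sample_space : measurableType disp;
  prob : probability sample_space R;
  mean : 'M[R]_(nrows, ncols);
  data : {RV prob >-> 'M[R]_(nrows, ncols)};
  mean_ok : parameter_matrix mean;
  data_ok : data_matrix mean data
}.

Record estimator (R : realType) := Estimator {
  estimate :> forall m n : nat, 'M[R]_(m, n) -> 'M[R]_(m, n);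
  measurable_estimate : forall m n, measurable_fun setT (@estimate m n)
}.

Record procedure (R : realType) := Procedure {
  mse_hat :> forall m n : nat, 'M[R]_(m, n) -> R;
  measurable_mse_hat : forall m n, measurable_fun setT (@mse_hat m n)
}.

Definition trivial_estimator (R : realType) : estimator R :=
  @Estimator R (fun _ _ X => X) (fun _ _ => @measurable_id _ _ setT).

Section MSE.
Context (R : realType).
Implicit Types (E : estimator R) (Q : procedure R) (D : nat -> model R).

Definition squared_error E (D : model R) (w : sample_space D) : R :=
  (nrows D * ncols D)%:R^-1 *
  \sum_i \sum_j (E _ _ (data D w) i j - mean D i j) ^+ 2.

(* Extended-real valued, since estimators need not be bounded. *)
Definition MSE E (D : model R) : \bar R := 'E_(prob D)[@squared_error E D]%E.

Definition nontrivial E : Prop :=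
  exists D : nat -> model R,
    ~ (MSE (trivial_estimator R) (D k) @[k --> \oo] --> 0%E) /\
    MSE E (D k) @[k --> \oo] --> 0%E.

Definition cvg_in_probability0 D (Y : forall k, sample_space (D k) -> R) : Prop :=
  forall e : R, 0 < e ->
    prob (D k) [set w | e <= `|Y k w| ] @[k --> \oo] --> 0%E.

Definition good_procedure E Q : Prop :=
  (forall D, MSE E (D k) @[k --> \oo] --> 0%E ->
     cvg_in_probability0 (fun k w => Q _ _ (data (D k) w))) /\
  (forall D, ~ (MSE E (D k) @[k --> \oo] --> 0%E) ->
     ~ cvg_in_probability0 (fun k w => Q _ _ (data (D k) w))).

End MSE.

(* Main.v *)
(* Let X_n have mean M_n, with MSE(E) -> 0 but E |X_n - M_n|^2 / mn not -> 0.  A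
   good procedure must output values near 0 on most realizations x of X_n.  Since
   E(x) is close to M_n while x itself is often far from M_n, some realization x
   has both a small output and |E(x) - x|^2 / mn bounded below.  But x could
   equally be a noiseless observation of the parameter matrix x, and for that
   model the true error |E(x) - x|^2 / mn is bounded below while the output is
   near 0. *)
Require Import Defs.
From mathcomp Require Import all_boot all_order all_algebra.
From mathcomp Require Import all_classical all_reals all_analysis.
From mathcomp Require Import measurable_realfun lra.

Set Implicit Arguments.
Unset Strict Implicit.
Unset Printing Implicit Defensive.

Import Order.TTheory GRing.Theory Num.Theory.
Import numFieldNormedType.Exports.

Local Open Scope classical_set_scope.
Local Open Scope ring_scope.

(** The values may be infinite, as the error of an unbounded estimator can be. A nonnegative value
    below a real bound is finite, so the right-hand side already yields the eventual finiteness that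
    convergence to 0 requires. *)
Lemma ge0_cvge0P (R : realType) (f : nat -> \bar R) :
  (forall k, 0 <= f k)%E ->
  f k @[k --> \oo] --> 0%E <->
  forall e : R, 0 < e -> \forall k \near \oo, (f k < e%:E)%E.
Proof.
move=> f0; split=> [/fine_cvgP[ffin /cvgr0Pnorm_lt fe] e e0|fe].
  near=> k.
  have fk : f k \is a fin_num by near: k.
  rewrite -(fineK fk) lte_fin (le_lt_trans (ler_norm _))//.
  by near: k; exact: fe.
have ffin e : 0 < e -> \forall k \near \oo, f k \is a fin_num /\ (f k < e%:E)%E.
  move=> e0; near=> k.
  have fk : (f k < e%:E)%E by near: k; exact: fe.
  by split=> //; rewrite ge0_fin_numE// (lt_trans fk)// ltry.
apply/fine_cvgP; split.
  by near=> k; have [] : f k \is a fin_num /\ (f k < 1%:E)%E by near: k; exact: ffin.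
apply/cvgr0Pnorm_lt => e e0; near=> k.
have [fk fke] : f k \is a fin_num /\ (f k < e%:E)%E by near: k; exact: ffin.
by rewrite /= ger0_norm ?fine_ge0// -lte_fin fineK.
Unshelve. all: by end_near. Qed.

Section MeanSquaredDistance.
Context (R : realType) (m n : nat).
Implicit Types A B C : 'M[R]_(m, n).

(** By conversion, [squared_error] is the [msd] between the estimate and the mean, both for [E] and
    for the trivial estimator. *)
Definition msd A B : R := (m * n)%:R^-1 * \sum_i \sum_j (A i j - B i j) ^+ 2.

Lemma msd_ge0 A B : 0 <= msd A B.
Proof.
by rewrite mulr_ge0 ?invr_ge0// sumr_ge0// => i _; rewrite sumr_ge0// => j _;
  rewrite sqr_ge0.
Qed.

Lemma msd_triangle C A B : msd A B <= 2 * msd C A + 2 * msd C B.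
Proof.
rewrite /msd !(mulrCA 2) -mulrDr ler_wpM2l ?invr_ge0// !mulr_sumr -big_split/=.
apply: ler_sum => i _; rewrite !mulr_sumr -big_split/=; apply: ler_sum => j _.
(* With a = A - C and b = B - C entrywise, (a - b)^2 = 2a^2 + 2b^2 - (a + b)^2. *)
have := sqr_ge0 (A i j - C i j + (B i j - C i j)); nra.
Qed.

Lemma msd_le4 A B : parameter_matrix A -> parameter_matrix B -> msd A B <= 4.
Proof.
move=> hA hB; apply: (@le_trans _ _ ((m * n)%:R^-1 * (4 * (m * n)%:R))).
  rewrite ler_wpM2l ?invr_ge0//.
  apply: (@le_trans _ _ (\sum_(i < m) \sum_(j < n) 4)); last first.
    by rewrite !sumr_const !card_ord -mulrnA mulnC mulr_natr.
  apply: ler_sum => i _; apply: ler_sum => j _.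
  move: (hA i j) (hB i j); rewrite !ler_norml => /andP[? ?] /andP[? ?].
  nra.
(* For an empty matrix the inverse of 0 is 0, and the bound still holds. *)
have [->|mn0] := eqVneq (m * n)%:R (0 : R); first by rewrite invr0 mul0r.
by rewrite mulrCA mulVf// mulr1.
Qed.

End MeanSquaredDistance.

Lemma measurable_entry (R : realType) m n (i : 'I_m) (j : 'I_n) :
  measurable_fun setT (fun A : 'M[R]_(m, n) => A i j).
Proof.
move=> _ B mB; rewrite setTI; apply: sub_sigma_algebra.
by exists i, j, B.
Qed.

Lemma measurable_msd d (T : measurableType d) (R : realType) m n
    (X : T -> 'M[R]_(m, n)) (M : 'M[R]_(m, n)) :
  measurable_fun setT X -> measurable_fun setT (fun w => msd (X w) M).
Proof.
move=> mX; apply: measurable_funM => //.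
apply: measurable_sum => i; apply: measurable_sum => j.
apply: measurable_funX; apply: measurable_funB => //.
exact: (measurableT_comp (measurable_entry i j) mX).
Qed.

Lemma measurable_squared_error (R : realType) (E : estimator R) (D : model R) :
  measurable_fun setT (@squared_error R E D).
Proof.
apply: measurable_msd.
exact: (measurableT_comp (@measurable_estimate R E _ _) (measurable_funPT (data D))).
Qed.

Lemma MSE_ge0 (R : realType) (E : estimator R) (D : model R) : (0 <= MSE E D)%E.
Proof. by apply: expectation_ge0 => w; exact: msd_ge0. Qed.

Section Noiseless.
Context (R : realType) (m n : nat) (dims : (0 < m <= n)%N).
Context d (T : measurableType d) (P : probability T R).
Context (x : 'M[R]_(m, n)) (x1 : parameter_matrix x).

(** Every event about a constant is full or empty: either all the factors are 1, or one factor is 0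
    and the intersection is empty. *)
Lemma independent_entries_cst : independent_entries P (cst x).
Proof.
move=> J B _ _.
have [allB|] := pselect (forall p, p \in J -> B p (x p.1 p.2)).
  rewrite big1 => [|p pJ].
    rewrite (_ : \bigcap_(i in _) _ = setT) ?probability_setT//.
    by apply/seteqP; split=> // w _ p; exact: allB.
  rewrite (_ : _ @^-1` _ = setT) ?probability_setT//.
  by apply/seteqP; split=> // w _; exact: allB.
move=> /existsNP[p /not_implyP[pJ Bp]].
rewrite (bigD1 p)//= (_ : entries _ p @^-1` _ = set0); last first.
  by apply/seteqP; split=> // w.
rewrite measure0 mul0e (_ : \bigcap_(i in _) _ = set0) ?measure0//.
by apply/seteqP; split=> // w /(_ p pJ).
Qed.

Lemma data_matrix_cst : data_matrix x (cst x : {RV P >-> 'M[R]_(m, n)}).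
Proof.
split=> [i j|i j|]; first by apply: aeW => w; exact: x1.
  exact: (expectation_cst P (x i j)).
by apply: Or31; exact: independent_entries_cst.
Qed.

Definition noiseless : model R := Model dims x1 data_matrix_cst.

Lemma MSE_noiseless (E : estimator R) : MSE E noiseless = (msd (E _ _ x) x)%:E.
Proof. exact: (expectation_cst P (msd (E _ _ x) x)). Qed.

End Noiseless.

(** If no such [x] existed, the trivial error would be at most delta/4 + 2 [t] + 4 [\1_A] almost
    surely, [t] being the squared error of [E]. The thresholds delta/8 and delta/16 keep the mean of
    this bound below 3 delta/4. *)
Lemma exists_misleading_realization (R : realType) (E : estimator R)
    (Q : procedure R) (D : model R) (delta e : R) :
  (delta%:E <= MSE (trivial_estimator R) D)%E ->
  (MSE E D < (delta / 8)%:E)%E ->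
  (prob D [set w | (e <= `|Q _ _ (data D w)|)%R] < (delta / 16)%:E)%E ->
  exists x : 'M[R]_(nrows D, ncols D),
    [/\ parameter_matrix x, `|Q _ _ x| < e & delta / 8 <= msd (E _ _ x) x].
Proof.
move=> trv_ge mse_lt; set A := [set w | _] => PA_lt.
(* Positivity of [delta] follows from 0 <= [MSE E D] < delta/8. *)
have d0 : 0 < delta by have := le_lt_trans (MSE_ge0 E D) mse_lt; rewrite lte_fin; lra.
have [//|/forallNP noX] := pselect (exists x : 'M[R]_(nrows D, ncols D),
  [/\ parameter_matrix x, `|Q _ _ x| < e & delta / 8 <= msd (E _ _ x) x]).
have mQ : measurable_fun setT (fun w => Q _ _ (data D w)).
  exact: (measurableT_comp (@measurable_mse_hat R Q _ _) (measurable_funPT (data D))).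
have mA : measurable A.
  rewrite -[A]setTI; apply: (@measurable_fun_le _ _ _ _ (cst e)) => //.
  exact: measurableT_comp.
pose t := @squared_error R E D.
have mt := @measurable_squared_error R E D.
have t0 w : 0 <= t w by exact: msd_ge0.
have X1 : {ae prob D, forall w, parameter_matrix (data D w)}.
  have [ae1 _ _] := data_ok D.
  by apply: filter_forall => i; apply: filter_forall => j; exact: ae1.
(* On [A] the crude bound 4 suffices. Off [A] the output is small, so [noX] forces the estimate
   within delta/8 of the data, and the triangle inequality through the estimate applies. The bound
   holds only almost surely because the entries of the data are bounded only almost surely. *)
have bound : {ae prob D, forall w, setT w ->
    ((@squared_error R (trivial_estimator R) D w)%:E <=
     (delta / 4)%:E + (2%:E * (t w)%:E + 4%:E * (\1_A w)%:E))%E}.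
  apply: filterS X1 => w Xw1 _.
  rewrite -!EFinM -!EFinD lee_fin indicE.
  have [wA|wA] := pselect (A w).
    rewrite mem_set//= mulr1.
    have : @squared_error R (trivial_estimator R) D w <= 4.
      exact: (msd_le4 Xw1 (@mean_ok R D)).
    by have := t0 w; lra.
  rewrite memNset//= mulr0 addr0.
  have Qw : `|Q _ _ (data D w)| < e by rewrite ltNge; exact/negP.
  have u : msd (E _ _ (data D w)) (data D w) < delta / 8.
    by rewrite ltNge; apply/negP => u; exact: (noX (data D w)).
  have : @squared_error R (trivial_estimator R) D w <=
      2 * msd (E _ _ (data D w)) (data D w) + 2 * t w.
    exact: (msd_triangle (E _ _ (data D w)) (data D w) (@mean R D)).
  by move: u; lra.
have m1 : measurable_fun setT (fun w => (t w)%:E) by exact/measurable_EFinP.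
have m2 : measurable_fun setT (fun w => (\1_A w)%:E : \bar R).
  exact/measurable_EFinP.
have m3 : measurable_fun setT (fun w => (2%:E * (t w)%:E)%E).
  exact: measurable_funeM.
have m4 : measurable_fun setT (fun w => (4%:E * (\1_A w)%:E)%E : \bar R).
  exact: measurable_funeM.
have t0E w : setT w -> (0 <= (t w)%:E)%E by rewrite lee_fin.
have i0E w : setT w -> (0 <= (\1_A w)%:E :> \bar R)%E by rewrite lee_fin.
have m5 : measurable_fun setT
    (fun w => (2%:E * (t w)%:E + 4%:E * (\1_A w)%:E)%E).
  exact: emeasurable_funD.
have n5 w : setT w -> (0 <= 2%:E * (t w)%:E + 4%:E * (\1_A w)%:E)%E.
  by move=> wT; rewrite adde_ge0// mule_ge0// ?t0E ?i0E.
have d4 w : setT w -> (0 <= (cst (delta / 4)%:E : sample_space D -> \bar R) w)%E.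
  by move=> _; rewrite lee_fin; lra.
have : (MSE (trivial_estimator R) D <=
    (delta / 4)%:E + (2%:E * MSE E D + 4%:E * prob D A))%E.
  have -> : ((delta / 4)%:E + (2%:E * MSE E D + 4%:E * prob D A) =
    \int[prob D]_w ((delta / 4)%:E + (2%:E * (t w)%:E + 4%:E * (\1_A w)%:E)))%E.
    rewrite (@ge0_integralD _ _ _ (prob D) _ measurableT (cst (delta / 4)%:E))//.
    rewrite integral_cst// [X in (_ = _ * X + _)%E](probability_setT (@prob R D)).
    rewrite mule1; congr (_ + _)%E.
    rewrite ge0_integralD//;
      try by move=> w wT; rewrite mule_ge0// ?t0E ?i0E.
    rewrite !ge0_integralZl_EFin// integral_indic// setIT.
    by rewrite /MSE unlock.
  rewrite /MSE unlock; apply: ae_ge0_le_integral => //.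
  - by move=> w _; rewrite lee_fin; exact: msd_ge0.
  - apply/measurable_EFinP.
    exact: (@measurable_squared_error R (trivial_estimator R) D).
  - by move=> w wT; rewrite adde_ge0 ?n5//; exact: (d4 w).
  - exact: emeasurable_funD.
move=> /(le_trans trv_ge).
have PA0 : (0 <= prob D A)%E by exact: measure_ge0.
have Et0 := MSE_ge0 E D.
have PAf : prob D A \is a fin_num by rewrite ge0_fin_numE// (lt_trans PA_lt)// ltry.
have Etf : MSE E D \is a fin_num by rewrite ge0_fin_numE// (lt_trans mse_lt)// ltry.
(* All terms are finite, so real arithmetic gives the contradiction delta < delta/4 + 2 (delta/8) +
   4 (delta/16). *)
move: PA_lt mse_lt; rewrite -(fineK PAf) -(fineK Etf) -!EFinM -!EFinD.
rewrite !lte_fin lee_fin => {PA0 Et0 bound t0E i0E n5 d4}; lra.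
Qed.

Theorem theorem1p3 (R : realType) (E : estimator R) (E_nontrivial : nontrivial E) :
  ~ exists Q : procedure R, good_procedure E Q.
Proof.
move=> [Q [Qa Qb]].
have [D [trvD ED]] := E_nontrivial.
(* Failure of convergence gives a lower bound only at arbitrarily large indices, not at all of
   them. *)
have [delta d0 trv_freq] : exists2 delta : R, 0 < delta &
    forall N, exists2 k, (N <= k)%N & (delta%:E <= MSE (trivial_estimator R) (D k))%E.
  apply: contrapT => /forall2NP trv_small; apply: trvD.
  apply/ge0_cvge0P => [k|e e0]; first exact: MSE_ge0.
  have [//|/existsNP[N /forall2NP noN]] := trv_small e.
  exists N => // k Nk; have [//|/negP] := noN k.
  by rewrite -ltNge.
have QD := Qa _ ED.
(* The realization is paired with its index [k], since its dimensions depend on [k]. The bound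
   1/(i+1) on the output will force convergence to 0. *)
have /choice[y yP] : forall i : nat,
    exists y : {k & 'M[R]_(nrows (D k), ncols (D k))},
    [/\ parameter_matrix (projT2 y), `|Q _ _ (projT2 y)| < i.+1%:R^-1 &
        delta / 8 <= msd (E _ _ (projT2 y)) (projT2 y)].
  move=> i.
  have i0 : 0 < i.+1%:R^-1 :> R by rewrite invr_gt0.
  have d8 : 0 < delta / 8 by rewrite divr_gt0.
  have d16 : 0 < delta / 16 by rewrite divr_gt0.
  have [N1 _ EN] := (ge0_cvge0P (fun k => MSE_ge0 E (D k))).1 ED _ d8.
  have [N2 _ QN] := (ge0_cvge0P (fun k => measure_ge0 (prob (D k)) _)).1 (QD _ i0) _ d16.
  have [k Nk trvk] := trv_freq (maxn N1 N2).
  have [||x xP] := @exists_misleading_realization R E Q (D k) delta i.+1%:R^-1 trvk.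
  - by apply: EN => /=; rewrite (leq_trans _ Nk)// leq_maxl.
  - by apply: QN => /=; rewrite (leq_trans _ Nk)// leq_maxr.
  by exists (existT _ k x).
have y1 i : parameter_matrix (projT2 (y i)) by have [] := yP i.
(* A constant can live on any probability space, so that of the original model is reused. *)
pose D' i := noiseless (dims_ok (D (projT1 (y i)))) (prob (D (projT1 (y i)))) (y1 i).
(* Along [D'] the error of [E] stays at least delta/8, while the output of [Q] is deterministic and
   tends to 0, contrary to the second clause of goodness. *)
apply: (Qb D') => [/(ge0_cvge0P (fun k => MSE_ge0 E (D' k)))|e e0].
  have d8 : 0 < delta / 8 by rewrite divr_gt0.
  move=> /(_ _ d8)[N _ /(_ N (leqnn N))].
  by rewrite /= MSE_noiseless lte_fin ltNge; have [_ _ ->] := yP N.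
(* Once 1/(i+1) < e, the deviation event is empty. *)
apply: cvg_near_cst; near=> i.
rewrite (_ : [set w | _] = set0) ?measure0//.
apply/seteqP; split=> // w /=; rewrite leNgt => /negP; apply.
have [_ /lt_le_trans Qy _] := yP i; apply: Qy.
by rewrite ltW//; near: i; exact: near_infty_natSinv_lt (PosNum e0).
Unshelve. all: by end_near. Qed.
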